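(* Let $f\colon[0,1]\to[0,\infty)$ be a bounded Borel function such that $\mathbf{E}_f$ is an equivalence relation. Then $f$ is continuous at $0$ if and only if $E_1\not\le_B\mathbf{E}_f$.
   Context: For $f\colon[0,1]\to[0,\infty)$, $\mathbf{E}_f$ is the relation on $[0,1]^{\omega}$ given by $(x_n)\,\mathbf{E}_f\,(y_n)\iff\sum_{n<\omega}f(|y_n-x_n|)<\infty$. $E_1$ denotes the equivalence relation of eventual equality on $[0,1]^{\omega}$: $(x_n)\,E_1\,(y_n)$ iff $x_n=y_n$ for all but finitely many $n$. For equivalence relations $E$ on a Polish space $X$ and $F$ on a Polish space $Y$, $E\le_B F$ ($E$ is Borel reducible to $F$) means there is a Borel function $\vartheta\colon X\to Y$ with $x\,E\,x'\iff\vartheta(x)\,F\,\vartheta(x')$ for all $x,x'\in X$. *)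

(* Defs.v *)
From mathcomp Require Import all_boot all_order all_algebra.
From mathcomp Require Import lra.
From mathcomp Require Import all_classical all_reals all_analysis.

Set Implicit Arguments.
Unset Strict Implicit.
Unset Printing Implicit Defensive.

Import Order.TTheory GRing.Theory Num.Theory.
Import numFieldNormedType.Exports.
Local Open Scope classical_set_scope.
Local Open Scope ring_scope.

(* Used as a type through the coercion [set_type], which carries the subspace
   topology. *)
Definition unitI (R : realType) : set R := `[0, 1].
Arguments unitI R : clear implicits.

Lemma zeroI_subproof (R : realType) : (0 : R) \in unitI R.
Proof. by rewrite inE /unitI /= in_itv /= lexx ler01. Qed.

Definition zeroI (R : realType) : unitI R := exist _ 0 (zeroI_subproof R).

Lemma distI_subproof (R : realType) (x y : unitI R) :
  `|set_val y - set_val x| \in unitI R.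
Proof.
rewrite set_valE; case: x y => [x xI] [y yI] /=.
move: xI yI; rewrite !inE /unitI /= !in_itv /= => /andP[x0 x1] /andP[y0 y1].
by rewrite normr_ge0 ler_norml; apply/andP; split; lra.
Qed.

Definition distI (R : realType) (x y : unitI R) : unitI R :=
  exist _ `|set_val y - set_val x| (distI_subproof x y).

Definition cube (R : realType) : topologicalType := {ptws nat -> unitI R}.

Definition borel_set (X : topologicalType) : set (set X) := <<s @open X >>.

(* [measurable_fun] is not used because the library's measurable types have to
   be pointed. *)
Definition borel_fun (X Y : topologicalType) (theta : X -> Y) : Prop :=
  forall B : set Y, borel_set B -> borel_set (theta @^-1` B).

Definition borel_reducible (X Y : topologicalType)
    (E : X -> X -> Prop) (F : Y -> Y -> Prop) : Prop :=
  exists2 theta : X -> Y, borel_fun theta &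
    forall x x' : X, E x x' <-> F (theta x) (theta x').

Definition E1 (R : realType) (x y : cube R) : Prop :=
  \forall n \near \oo, x n = y n.

(* For nonnegative [f] the partial sums are nondecreasing, so the sum always
   exists in [\bar R] and being [< +oo] means that the real series converges. *)
Definition Esum (R : realType) (f : unitI R -> R) (x y : cube R) : Prop :=
  (\sum_(0 <= n <oo) (f (distI (x n) (y n)))%:E < +oo)%E.

(* Main.v *)
(** Write [D_n(u, v)] for the n-th partial sum of [f(|v_i - u_i|)]. Interleaving
infinitely many counterexamples shows that transitivity of [E_f] is automatically
uniform: for every [e] there is [d] such that [D_n(u, v), D_n(v, w) <= d] imply
[D_n(u, w) <= e], for all [n]. The rest is Baire category on binary sequences.

Suppose that [f] is continuous at [0] and that [theta] is a Borel reduction. Code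
points of the cube by binary matrices [x], row [n] being an expansion of the n-th
coordinate. Erasing row [k] of [x] gives an [E_1]-equivalent point, so [theta(x)]
is close, in the sense of [D], to one of the countably many sequences obtained
from [theta(x with row k erased)] by changing finitely many terms to rationals.
Hence countably many sets with the Baire property cover the space, and flipping a
bit of row [k] inside one of them moves [theta(x)] by little. A generic [x]
therefore tolerates the flip of any sufficiently late bit of row [k]. Flipping one
bit in each row in turn yields two generic points that differ in every coordinate
but have [E_f]-equivalent images.

If [f] is not continuous at [0], pick [t_j <= 2^-(j+1)] with [f(t_j) > e] and put
[h(a) = sum_j a_j t_j]. Flipping bit [j] of [a] moves [h(a)] by exactly [t_j], so
by uniform transitivity [{(a, b) | f(|h(a) - h(b)|) <= d}] is meager for small
[d]. By Mycielski's theorem there is a continuous [phi] with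
[f(|h(phi(a)) - h(phi(b))|) > d] whenever [a <> b], and applying [h \o phi] to
Dedekind cuts coordinatewise reduces [E_1] to [E_f]. *)

Require Import Defs.
From HB Require Import structures.
From mathcomp Require Import all_boot all_order all_algebra.
From mathcomp Require Import lra.
From mathcomp Require Import all_classical all_reals all_analysis.
From mathcomp Require Import measurable_realfun.

Import Order.TTheory GRing.Theory Num.Theory.
Import numFieldNormedType.Exports.
Local Open Scope classical_set_scope.
Local Open Scope ring_scope.

Set Implicit Arguments.
Unset Strict Implicit.
Unset Printing Implicit Defensive.

(** * Dependent choice and countable operations in sigma-algebras *)

Lemma dependent_choice_nat (T : Type) (P : nat -> T -> T -> Prop) (x0 : T) :
    (forall n x, exists y, P n x y) ->
  exists2 s : nat -> T, s 0%N = x0 & forall n, P n (s n) (s n.+1).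
Proof.
move=> ex; have [g gP] := choice (fun p : nat * T => ex p.1 p.2).
exists (fun n => iteri n (fun k x => g (k, x)) x0) => // n.
exact: (gP (_, _)).
Qed.

Section sigma_algebra.
Variables (T : Type) (S : set (set T)).
Hypothesis S_sigma : sigma_algebra setT S.

Lemma sigma_algebra_setC (A : set T) : S A -> S (~` A).
Proof. by case: S_sigma => _ SC _ /SC; rewrite setTD. Qed.

Lemma sigma_algebra_countable_bigcup (L : countType) (A : L -> set T) :
  (forall l, S (A l)) -> S (\bigcup_l A l).
Proof.
move=> SA; case: (S_sigma) => S0 _ SU.
rewrite (_ : \bigcup_l A l =
    \bigcup_n (if unpickle n is Some l then A l else set0)).
  by apply: SU => n; case: unpickle.
apply/seteqP; split=> [t [l _ At]|t [n _]].
  by exists (pickle l) => //; rewrite pickleK.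
by case: unpickle => // l At; exists l.
Qed.

Lemma sigma_algebra_countable_bigcap (L : countType) (A : L -> set T) :
  (forall l, S (A l)) -> S (\bigcap_l A l).
Proof.
move=> SA; rewrite -[X in S X]setCK setC_bigcap.
apply/sigma_algebra_setC/sigma_algebra_countable_bigcup => l.
exact: sigma_algebra_setC.
Qed.

End sigma_algebra.

(** * Baire category on binary sequences *)

Section category.
Variable K : countType.
Implicit Types (k p : K) (x y z : K -> bool) (U V A G : set (K -> bool)).

(** A basic clopen set: [pickle] is injective, so only finitely many coordinates have a code below
    [m]. *)
Definition agree (m : nat) x y : Prop := forall k, (pickle k < m)%N -> x k = y k.

Lemma agree_sym m x y : agree m x y -> agree m y x.
Proof. by move=> xy k km; rewrite xy. Qed.

Lemma agree_trans m x y z : agree m x y -> agree m y z -> agree m x z.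
Proof. by move=> xy yz k km; rewrite xy// yz. Qed.

Lemma agree_le m n x y : (m <= n)%N -> agree n x y -> agree m x y.
Proof. by move=> mn xy k km; apply: xy; exact: leq_trans mn. Qed.

Definition cyl_open U := forall x, U x -> exists m, forall y, agree m x y -> U y.

Definition cyl_dense U := forall x m, exists2 y, agree m x y & U y.

Definition comeager G := exists2 W : nat -> set (K -> bool),
  forall n, cyl_open (W n) /\ cyl_dense (W n) & \bigcap_n W n `<=` G.

Definition baire A :=
  exists2 U, cyl_open U & comeager [set x | A x <-> U x].

Lemma comeagerS G1 G2 : G1 `<=` G2 -> comeager G1 -> comeager G2.
Proof. by move=> G12 [W WP WG]; exists W => // x /WG/G12. Qed.

Lemma comeager_open U : cyl_open U -> cyl_dense U -> comeager U.
Proof. by move=> oU dU; exists (fun=> U) => // x /(_ 0%N); apply. Qed.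

Lemma comeager_bigcap (J : countType) (G : J -> set (K -> bool)) :
  (forall j, comeager (G j)) -> comeager (\bigcap_j G j).
Proof.
move=> cG; have [W WP WG] := all_sig2 (fun j => cid2 (cG j)).
exists (fun n => if unpickle n is Some (j, k) then W j k else setT).
  by move=> n; case: unpickle => [[j k]|]; [exact: WP|split=> // x;
    [exists 0%N|exists x]].
by move=> x Wx j _; apply: WG => k _; have /= := Wx (pickle (j, k)) Logic.I;
  rewrite pickleK.
Qed.

Lemma comeagerI G1 G2 : comeager G1 -> comeager G2 -> comeager (G1 `&` G2).
Proof.
move=> c1 c2; have := @comeager_bigcap bool (fun b => if b then G1 else G2).
move=> /(_ _)/comeagerS; apply; last by case.
by move=> x Gx; split; [exact: (Gx true)|exact: (Gx false)].
Qed.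

Lemma baire_open U : cyl_open U -> baire U.
Proof. by move=> oU; exists U => //; exists (fun=> setT) => // n; split=> // x;
  [exists 0%N|exists x]. Qed.

(** The exterior of [U] serves for the complement, since [U] and its exterior have an open dense
    union. *)
Lemma baire_setC A : baire A -> baire (~` A).
Proof.
move=> [U oU cU].
have oV : cyl_open [set x | exists m, forall y, agree m x y -> ~ U y].
  move=> x [m xm]; exists m => y xy; exists m => z yz.
  by apply: xm; exact: agree_trans yz.
exists [set x | exists m, forall y, agree m x y -> ~ U y] => //.
have : comeager (U `|` [set x | exists m, forall y, agree m x y -> ~ U y]).
  apply: comeager_open.
    move=> x [/oU[m xm]|/oV[m xm]]; exists m => y xy.
      by left; exact: xm.
    by right; exact: xm.
  move=> x m; have [[y xy Uy]|nex] := pselect (exists2 y, agree m x y & U y).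
    by exists y => //; left.
  by exists x => //; right; exists m => y xy Uy; apply: nex; exists y.
move=> /(comeagerI cU); apply: comeagerS => x [/= AU UV]; split.
  by move=> nA; case: UV => // /AU.
by move=> [m xm] /AU Ux; exact: (xm x).
Qed.

Lemma baire_bigcup (A : (set (K -> bool))^nat) :
  (forall n, baire (A n)) -> baire (\bigcup_n A n).
Proof.
move=> bA; have [U oU cU] := all_sig2 (fun n => cid2 (bA n)).
exists (\bigcup_n U n).
  by move=> x [n _ /oU[m xm]]; exists m => y /xm Uy; exists n.
apply: comeagerS (comeager_bigcap cU) => x AU.
by split=> -[n _ Ax]; exists n => //; apply/(AU n).
Qed.

Lemma baire_sigma_algebra : sigma_algebra setT baire.
Proof.
split; first exact: baire_open.
  by move=> A bA; rewrite setTD; exact: baire_setC.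
exact: baire_bigcup.
Qed.

Lemma sub_baire (S : set (set (K -> bool))) :
  S `<=` baire -> <<s S >> `<=` baire.
Proof. by move=> Sb; apply: smallest_sub => //; exact: baire_sigma_algebra. Qed.

(** As [n <= m n], coordinate [k] no longer changes from stage [(pickle k).+1] on; the limit reads
    it off there. *)
Lemma agree_limit (s : nat -> K -> bool) (m : nat -> nat) :
    (forall n, n <= m n)%N -> (forall n, m n <= m n.+1)%N ->
    (forall n, agree (m n) (s n) (s n.+1)) ->
  exists x, forall n, agree (m n) (s n) x.
Proof.
move=> m_ge m_le sP.
have m_mono n i : (m n <= m (n + i))%N.
  by elim: i => [|i ih]; rewrite ?addn0// addnS (leq_trans ih).
have s_agree n i : agree (m n) (s n) (s (n + i)%N).
  elim: i => [|i ih]; rewrite ?addn0// addnS.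
  exact: agree_trans ih (agree_le (m_mono n i) (sP _)).
exists (fun k => s (pickle k).+1 k) => n k km.
set c := (pickle k).+1; have [nc|/ltnW cn] := leqP n c.
  by rewrite -(subnKC nc) (s_agree n (c - n)%N).
by rewrite -[in LHS](subnKC cn) -(s_agree c (n - c)%N)//; exact: m_ge.
Qed.

(** The Baire category theorem: cylinders [(x, m)] shrink successively into the [W n], and their
    limit is taken. *)
Lemma comeager_nonempty G : comeager G -> exists x, G x.
Proof.
move=> [W WP WG].
have step n (p : (K -> bool) * nat) : exists q,
    [/\ agree p.2 p.1 q.1, (p.2 < q.2)%N & forall y, agree q.2 q.1 y -> W n y].
  case: p => x m; have [oW /(_ x m)[y xy /oW[k yk]]] := WP n.
  exists (y, maxn k m.+1); split=> //=; first by rewrite leq_max ltnSn orbT.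
  by move=> z yz; apply: yk; apply: agree_le yz; rewrite leq_maxl.
have [s _ sP] := dependent_choice_nat (xpred0, 0%N) step.
have [||n|x xP] := @agree_limit (fun n => (s n).1) (fun n => (s n).2).
- by elim=> // n ih; apply: leq_ltn_trans ih _; have [] := sP n.
- by move=> n; apply: ltnW; have [] := sP n.
- by have [] := sP n.
by exists x; apply: WG => n _; have [_ _] := sP n; apply; exact: xP.
Qed.

Definition flip p x : K -> bool := fun k => x k (+) (k == p).

Lemma flipK p : involutive (flip p).
Proof. by move=> x; apply/funext => k; rewrite /flip addbK. Qed.

Lemma agree_flip m p x y : agree m x y -> agree m (flip p x) (flip p y).
Proof. by move=> xy k km; rewrite /flip xy. Qed.

Lemma agree_flip_ge m p x : (m <= pickle p)%N -> agree m x (flip p x).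
Proof.
move=> mp k km; rewrite /flip (_ : (k == p) = false) ?addbF//.
by apply/eqP => kp; move: km; rewrite kp ltnNge mp.
Qed.

Lemma flips_open_dense (l : seq K) U : cyl_open U -> cyl_dense U ->
  cyl_open [set x | U (foldr flip x l)] /\ cyl_dense [set x | U (foldr flip x l)].
Proof.
elim: l U => // p l ih U oU dU; apply: (ih [set x | U (flip p x)]).
  by move=> x /oU[m xm]; exists m => y /(agree_flip p)/xm.
move=> x m; have [y xy Uy] := dU (flip p x) m.
exists (flip p y); last by rewrite /= flipK.
by rewrite -[x](flipK p); exact: agree_flip.
Qed.

(** Flips are homeomorphisms, so preimages of dense open sets under the countably many finite
    products of flips are dense open; intersecting them makes the generic set flip-invariant. *)
Lemma baire_generic (J : countType) (A : J -> set (K -> bool)) :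
    (forall j, baire (A j)) ->
  exists (U : J -> set (K -> bool)) (W : nat -> set (K -> bool)),
  [/\ forall j, cyl_open (U j),
      forall n, cyl_open (W n) /\ cyl_dense (W n),
      forall j x, (\bigcap_n W n) x -> (A j x <-> U j x) &
      forall p x, (\bigcap_n W n) x -> (\bigcap_n W n) (flip p x)].
Proof.
move=> bA; have [U oU /comeager_bigcap[W WP WAU]] :=
  all_sig2 (fun j => cid2 (bA j)).
pose W' n := if unpickle n is Some (i, l)
  then [set x | W i (foldr flip x l)] else setT.
have W'P n l x : (\bigcap_n W' n) x -> W n (foldr flip x l).
  by move=> /(_ (pickle (n, l)) Logic.I); rewrite /W' pickleK.
exists U, W'; split => //.
- move=> n; rewrite /W'; case: unpickle => [[i l]|].
    by have [? ?] := WP i; exact: flips_open_dense.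
  by split=> x; [exists 0%N|exists x].
- by move=> j x W'x; apply: WAU => // n _; exact: (W'P n [::]).
- move=> p x W'x n _; rewrite /W'; case: unpickle => [[i l]|]//=.
  by rewrite -foldr_rcons; exact: W'P.
Qed.

End category.

Definition cyl_continuous (K L : countType) (F : (K -> bool) -> L -> bool) :=
  forall x m, exists n, forall y, agree n x y -> agree m (F x) (F y).

Lemma agree_comp (K L : countType) (e : L -> K) (m : nat) :
  exists n, forall x y, agree n x y -> agree m (x \o e) (y \o e).
Proof.
pose b (c : 'I_m) := if unpickle c is Some l then (pickle (e l)).+1 else 0%N.
exists (\max_c b c) => x y xy l lm /=; apply: xy.
by apply: leq_trans (leq_bigmax (Ordinal lm)); rewrite /b /= pickleK.
Qed.

(** * Mycielski's theorem by fusion *)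

Section mycielski.
Local Notation word := (seq bool).
Implicit Types (a b u v : nat -> bool) (r s t : word).

(** A pair as one point over [bool * nat], so that the category notions apply to subsets of the
    square. *)
Definition pair_bits a b : bool * nat -> bool := fun p => (if p.1 then a else b) p.2.

Lemma agree_pair_bits m : exists n, forall a b a' b',
  agree n a a' -> agree n b b' -> agree m (pair_bits a b) (pair_bits a' b').
Proof.
have [n nP] := agree_comp (@snd bool nat) m.
exists n => a b a' b' /nP aa' /nP bb' [c j] cj.
by case: c cj => cj; [exact: aa'|exact: bb'].
Qed.

Lemma pair_bits_agree m : exists n, forall a b x, agree n (pair_bits a b) x ->
  agree m a (fun j => x (true, j)) /\ agree m b (fun j => x (false, j)).
Proof.
have [n nP] := agree_comp (@pair bool nat true) m.
have [n' n'P] := agree_comp (@pair bool nat false) m.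
exists (maxn n n') => a b x abx; split.
  exact: (nP (pair_bits a b) x (agree_le (leq_maxl _ _) abx)).
exact: (n'P (pair_bits a b) x (agree_le (leq_maxr _ _) abx)).
Qed.

(* In a fusion state [(g, m)], the first [m] bits of [g s] are those of [phi a] for
   every [a] extending the word [s]. *)
Lemma mycielski_step1 (V : set (bool * nat -> bool)) s t (g : word -> nat -> bool) m :
    cyl_open V -> cyl_dense V -> s != t ->
  exists (g' : word -> nat -> bool) m', [/\ (m <= m')%N,
    forall r, agree m (g r) (g' r) &
    forall u v, agree m' (g' s) u -> agree m' (g' t) v -> V (pair_bits u v)].
Proof.
move=> oV dV st; have [n nP] := pair_bits_agree m.
have [x /nP[gs gt] /oV[i iP]] := dV (pair_bits (g s) (g t)) n.
have [i' i'P] := agree_pair_bits i.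
exists (fun r => if r == s then fun j => x (true, j) else
         if r == t then fun j => x (false, j) else g r), (maxn m i').
split=> [|r|u v]; first by rewrite leq_maxl.
  by case: eqP => [->//|_]; case: eqP => [->|].
rewrite eqxx eq_sym (negbTE st) eqxx => su tv; apply: iP.
rewrite (_ : x = pair_bits (fun j => x (true, j)) (fun j => x (false, j))).
  by apply: i'P; [apply: agree_le su|apply: agree_le tv]; rewrite leq_maxr.
by apply/funext => -[[] j].
Qed.

Variable W : nat -> set (bool * nat -> bool).
Hypothesis W_open_dense : forall n, cyl_open (W n) /\ cyl_dense (W n).

(** Requirements are met one at a time; those already met persist, since later states only refine
    the cylinders. *)
Lemma mycielski_step (l : seq (nat * (word * word))) (g : word -> nat -> bool) m :
  exists (g' : word -> nat -> bool) m', [/\ (m <= m')%N,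
    forall r, agree m (g r) (g' r) &
    forall n s t, (n, (s, t)) \in l -> s != t ->
    forall u v, agree m' (g' s) u -> agree m' (g' t) v -> W n (pair_bits u v)].
Proof.
elim: l => [|[n [s t]] l [g1 [m1 [mm1 gg1 lP]]]]; first by exists g, m.
have [st|st] := eqVneq s t.
  exists g1, m1; split=> // n' s' t'; rewrite inE => /orP[/eqP[_ -> ->]|/lP//].
  by rewrite st eqxx.
have [oW dW] := W_open_dense n.
have [g2 [m2 [m12 g12 g2P]]] := mycielski_step1 g1 m1 oW dW st.
exists g2, m2; split=> [|r|n' s' t']; first exact: leq_trans m12.
  by apply: agree_trans (gg1 r) _; apply: agree_le (g12 r).
rewrite inE => /orP[/eqP[-> -> ->]//|/lP + s't' u v su tv].
by move=> /(_ s't'); apply; [have := su|have := tv];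
  move=> /(agree_le m12); apply: agree_trans.
Qed.

(** Stage [n] sends all pairs of distinct words of length [n.+1] into [W 0, ..., W n]; [phi a] is
    the limit along the prefixes of [a]. *)
Lemma mycielski : exists2 phi : (nat -> bool) -> nat -> bool,
  cyl_continuous phi &
  forall a b, a <> b -> (\bigcap_n W n) (pair_bits (phi a) (phi b)).
Proof.
have step n (p : (word -> nat -> bool) * nat) :
    exists q : (word -> nat -> bool) * nat, [/\ (p.2 < q.2)%N,
      forall r, agree p.2 (p.1 (take n r)) (q.1 r) &
      forall i s t, (i <= n)%N -> size s = n.+1 -> size t = n.+1 -> s != t ->
      forall u v, agree q.2 (q.1 s) u -> agree q.2 (q.1 t) v ->
      W i (pair_bits u v)].
  case: p => g m.
  pose l := [seq (val z.1, (val z.2.1, val z.2.2))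
    | z : 'I_n.+1 * (n.+1.-tuple bool * n.+1.-tuple bool)].
  have [g' [m' [mm' gg' g'P]]] := mycielski_step l (fun r => g (take n r)) m.+1.
  exists (g', m'); split=> //= [r|i s t lein /eqP sn /eqP tn].
    exact: agree_le (gg' r).
  apply: g'P; apply/mapP.
  by exists (Ordinal (lein : (i < n.+1)%N), (Tuple sn, Tuple tn)); rewrite ?mem_enum.
have [s _ sP] := dependent_choice_nat (fun=> xpred0, 0%N) step.
have s_ge n : (n <= (s n).2)%N.
  by elim: n => // n ih; apply: leq_ltn_trans ih _; have [] := sP n.
have lim a : exists b, forall n, agree (s n).2 ((s n).1 (mkseq a n)) b.
  apply: (@agree_limit _ (fun n => (s n).1 (mkseq a n)) (fun n => (s n).2)) => //.
    by move=> n; apply: ltnW; have [] := sP n.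
  move=> n; have [_ /(_ (mkseq a n.+1)) + _] := sP n.
  by rewrite /mkseq -map_take take_iota (minn_idPl _).
have [phi phiP] := choice lim; exists phi.
  move=> a m; exists m => b ab; apply: agree_le (s_ge m) _.
  apply: agree_trans (agree_sym (phiP a m)) _.
  rewrite (_ : mkseq a m = mkseq b m)//; apply/eq_in_map => j.
  by rewrite mem_iota => /andP[_ jm]; exact: ab.
move=> a b ab n _.
have [j abj] : exists j, a j != b j.
  apply: contrapT => nab; apply: ab; apply/funext => j.
  by apply/eqP/negPn/negP => abj; apply: nab; exists j.
(* The prefixes compared at stage [maxn n j] have one more bit, hence include the differing bit [j];
   the stage also covers [W n]. *)
have [_ _ /(_ n (mkseq a (maxn n j).+1) (mkseq b (maxn n j).+1))] := sP (maxn n j).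
apply; rewrite ?size_mkseq ?leq_maxl//.
apply/eqP => /(congr1 (nth false ^~ j)); rewrite !nth_mkseq ?ltnS ?leq_maxr//.
exact/eqP.
Qed.

End mycielski.

(** * Uniform transitivity *)

Lemma nneseries_finiteP (R : realType) (a : nat -> R) : (forall n, 0 <= a n) ->
  (\sum_(0 <= n <oo) (a n)%:E < +oo)%E <->
  exists r, forall N, \sum_(0 <= n < N) a n <= r.
Proof.
move=> a0; have a0E n : (0 <= (a n)%:E)%E by rewrite lee_fin.
split=> [afin|[r ar]].
  have afn : (\sum_(0 <= n <oo) (a n)%:E)%E \is a fin_num.
    by rewrite ge0_fin_numE// nneseries_ge0.
  exists (fine (\sum_(0 <= n <oo) (a n)%:E)%E) => N.
  by rewrite -lee_fin fineK// -sumEFin nneseries_lim_ge.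
apply: le_lt_trans (ltry r); apply: lime_le; first exact: is_cvg_nneseries.
by near=> N; rewrite sumEFin lee_fin.
Unshelve. all: by end_near. Qed.

Lemma nneseries_pickle (R : realType) (g : nat -> nat -> \bar R) :
    (forall n i, 0 <= g n i)%E ->
  (\sum_(0 <= p <oo) (if pickle_inv p is Some (n, i) then g n i else 0) =
   \sum_(0 <= n <oo) \sum_(0 <= i <oo) g n i)%E.
Proof.
move=> g0; rewrite nneseries_esumT; last by move=> p; case: pickle_inv => [[n i]|].
rewrite [RHS]nneseries_esumT; last by move=> n; exact: nneseries_ge0.
under [RHS]eq_esum do rewrite nneseries_esumT//.
rewrite esum_esum// (_ : _ `*`` _ = setT); last exact/seteqP.
rewrite (_ : \esum_(p in _) _ = \esum_(p in range (@pickle (nat * nat)%type))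
    (if pickle_inv p is Some (n, i) then g n i else 0)%E); last first.
  rewrite [RHS]esum_mkcond; apply: eq_esum => p _; case: ifPn => // /negP pN.
  case: pickle_inv (pickle_invK (T := (nat * nat)%type) p) => //= ni pE.
  by case: pN; rewrite inE; exists ni.
rewrite esum_image; last by move=> x y _ _; exact: (pcan_inj pickleK).
by apply: eq_esum => -[n i] _; rewrite pickleK_inv.
Qed.

Section distI.
Variable R : realType.
Implicit Types s t : unitI R.

Lemma unitI_itv t : 0 <= set_val t <= 1.
Proof. by have := set_valP t; rewrite /unitI /= in_itv. Qed.

Lemma unitI_inj : injective (set_val : unitI R -> R).
Proof. exact: val_inj. Qed.

Lemma set_val_distI s t : set_val (distI s t) = `|set_val t - set_val s|.
Proof. by []. Qed.

Lemma distIC s t : distI s t = distI t s.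
Proof. by apply: unitI_inj; rewrite !set_val_distI distrC. Qed.

Lemma distIxx t : distI t t = zeroI R.
Proof. by apply: unitI_inj; rewrite set_val_distI subrr normr0. Qed.

(** Reals outside the interval go to 0, not to the nearest endpoint. *)
Definition clampI (r : R) : unitI R :=
  if pselect (r \in unitI R) is left h then exist _ r h else zeroI R.

Lemma set_val_clampI (r : R) : 0 <= r <= 1 -> set_val (clampI r) = r.
Proof.
move=> r01; rewrite /clampI; case: pselect => //= -[].
by rewrite inE /unitI /= in_itv.
Qed.
End distI.

Section sums.
Variables (R : realType) (f : unitI R -> R).
Hypothesis f_ge0 : forall t, 0 <= f t.
Implicit Types u v w : cube R.

(** With [m = 0] this is the partial sum [D_n]; other [m] give tails. *)
Definition dist_sum (m n : nat) u v : R := \sum_(m <= i < n) f (distI (u i) (v i)).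

Lemma EsumP u v : Esum f u v <-> exists r, forall n, dist_sum 0 n u v <= r.
Proof. exact: nneseries_finiteP. Qed.

Lemma dist_sumC m n u v : dist_sum m n u v = dist_sum m n v u.
Proof. by apply: eq_bigr => i _; rewrite distIC. Qed.

Lemma dist_sum_ge0 m n u v : 0 <= dist_sum m n u v.
Proof. exact: sumr_ge0. Qed.

Lemma dist_sum_cat n m p u v : (m <= n)%N -> (n <= p)%N ->
  dist_sum m p u v = dist_sum m n u v + dist_sum n p u v.
Proof. by move=> mn np; rewrite /dist_sum (big_cat_nat mn np). Qed.

Lemma dist_sum_le n m u v : (m <= n)%N -> dist_sum 0 m u v <= dist_sum 0 n u v.
Proof. by move=> mn; rewrite (@dist_sum_cat m 0%N n)// lerDl dist_sum_ge0. Qed.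

Lemma Esum_tail u v (e : R) : Esum f u v -> 0 < e ->
  exists N, forall n, dist_sum N n u v <= e.
Proof.
move=> /EsumP[r ur] e0.
have hs : has_sup (range (fun n => dist_sum 0 n u v)).
  split; first by exists (dist_sum 0 0 u v), 0%N.
  by exists r => _ [n _ <-].
have [_ [N _ <-] NP] := sup_adherent e0 hs.
exists N => n; have [nN|Nn] := leqP n N.
  by rewrite /dist_sum big_geq// ltW.
have : dist_sum 0 n u v <= sup (range (fun n => dist_sum 0 n u v)).
  by apply: ub_le_sup; [exact: hs.2|exists n].
by rewrite (@dist_sum_cat N 0%N n)// 1?ltnW//; lra.
Qed.

Hypothesis Ef_equiv : RelationClasses.Equivalence (Esum f).

(** Reflexivity at a constant sequence bounds all multiples of [f (zeroI R)]. *)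
Lemma f_zeroI : f (zeroI R) = 0.
Proof.
have [r rP] : exists r, forall n, dist_sum 0 n (fun=> zeroI R) (fun=> zeroI R) <= r.
  by apply/EsumP; case: Ef_equiv => + _ _; apply.
apply/eqP; rewrite eq_le f_ge0 andbT leNgt; apply/negP => f0.
have := rP (Num.trunc (r / f (zeroI R))).+1.
rewrite /dist_sum distIxx sumr_const_nat subn0 -mulr_natr leNgt mulrC.
by rewrite -ltr_pdivrMr// truncnS_gt.
Qed.

Let trunc (u : cube R) (n : nat) : cube R := fun i => if (i < n)%N then u i else zeroI R.

(** Finite blocks of lengths [N k] are interleaved into one pair of sequences; the padding costs
    [f (zeroI R) = 0]. *)
Lemma Esum_pickle (u v : nat -> cube R) (N : nat -> nat) :
  Esum f (fun p => if pickle_inv p is Some (n, i) then trunc (u n) (N n) i else zeroI R)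
         (fun p => if pickle_inv p is Some (n, i) then trunc (v n) (N n) i else zeroI R)
  <-> exists r, forall n, \sum_(0 <= k < n) dist_sum 0 (N k) (u k) (v k) <= r.
Proof.
rewrite -nneseries_finiteP; last by move=> n; exact: dist_sum_ge0.
rewrite /Esum; set S1 := (\sum_(_ <= _ <oo) _)%E; set S2 := (\sum_(_ <= _ <oo) _)%E.
suff -> : S1 = S2 by [].
have -> : S1 = (\sum_(0 <= p <oo) (if pickle_inv p is Some (n, i) then
    (f (distI (trunc (u n) (N n) i) (trunc (v n) (N n) i)))%:E else 0))%E.
  apply: eq_eseriesr => p _; case: pickle_inv => [[n i]|]//.
  by rewrite distIxx f_zeroI.
rewrite nneseries_pickle; last by move=> n i; rewrite lee_fin.
apply: eq_eseriesr => n _.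
rewrite (nneseries_split _ (N n)); last by move=> i _; rewrite lee_fin.
rewrite add0n [X in (_ + X)%E]eseries0 ?adde0; last first.
  by move=> i Ni _; rewrite /trunc ltnNge Ni/= distIxx f_zeroI.
rewrite sumEFin; congr EFin; apply: eq_big_nat => i /andP[_ iN].
by rewrite /trunc iN.
Qed.

(** Otherwise choose a counterexample for each [2^-k]. Interleaved, the first two sums are at most
    2, so the third is finite, yet every block adds more than [e] to it. *)
Lemma dist_sum_trans (e : R) : 0 < e -> exists2 d, 0 < d &
  forall n u v w, dist_sum 0 n u v <= d -> dist_sum 0 n v w <= d ->
    dist_sum 0 n u w <= e.
Proof.
move=> e0; apply: contrapT => nex.
have /choice[c cP] : forall k : nat, exists c : nat * (cube R * cube R * cube R),
    [/\ dist_sum 0 c.1 c.2.1.1 c.2.1.2 <= 2^-1 ^+ k,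
        dist_sum 0 c.1 c.2.1.2 c.2.2 <= 2^-1 ^+ k &
        e < dist_sum 0 c.1 c.2.1.1 c.2.2].
  move=> k; apply: contrapT => nc; apply: nex; exists (2^-1 ^+ k).
    by rewrite exprn_gt0// invr_gt0.
  move=> n u v w uv vw; rewrite leNgt; apply/negP => uw.
  by apply: nc; exists (n, (u, v, w)).
pose N k := (c k).1.
have geo n : \sum_(0 <= k < n) (2^-1 : R) ^+ k <= 2.
  suff -> : \sum_(0 <= k < n) (2^-1 : R) ^+ k = 2 - 2 * 2^-1 ^+ n.
    by rewrite gerBl mulr_ge0// exprn_ge0// invr_ge0.
  elim: n => [|n ih]; first by rewrite big_geq// expr0 mulr1 subrr.
  by rewrite big_nat_recr//= ih exprS; lra.
have uv := (Esum_pickle (fun k => (c k).2.1.1) (fun k => (c k).2.1.2) N).2.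
have vw := (Esum_pickle (fun k => (c k).2.1.2) (fun k => (c k).2.2) N).2.
have uw := (Esum_pickle (fun k => (c k).2.1.1) (fun k => (c k).2.2) N).1.
have {uw}[|r rP] := uw.
  case: Ef_equiv => _ _ tr; apply: tr (uv _) (vw _); exists 2 => n;
    (apply: le_trans (geo n); apply: ler_sum => k _; by have [] := cP k).
have := rP (Num.trunc (r / e)).+1; apply/negP; rewrite -ltNge.
apply: (@lt_le_trans _ _ ((Num.trunc (r / e)).+1%:R * e)).
  by rewrite -ltr_pdivrMr// truncnS_gt.
rewrite mulr_natl -[X in _ *+ X]subn0 -sumr_const_nat.
by apply: ler_sum => k _; have [_ _ /ltW] := cP k.
Qed.

Lemma f_trans (e : R) : 0 < e -> exists2 d, 0 < d &
  forall r s t, f (distI r s) <= d -> f (distI s t) <= d -> f (distI r t) <= e.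
Proof.
move=> /dist_sum_trans[d d0 dP]; exists d => // r s t rs st.
by have := dP 1%N (fun=> r) (fun=> s) (fun=> t);
  rewrite /dist_sum !big_nat1; apply.
Qed.

End sums.

(** * Weighted binary expansions *)

Section binary.
Variables (R : realType) (w : nat -> R).
Hypothesis w_ge0 : forall j, 0 <= w j.
Hypothesis w_le : forall j, w j <= 2^-1 ^+ j.+1.
Implicit Types a b : nat -> bool.

Let term a j := if a j then w j else 0.

Let term_ge0 a j : 0 <= term a j.
Proof. by rewrite /term; case: ifP. Qed.

(** Weights [2^-(j+1)] give binary expansions; the discontinuous case uses points at which [f] is
    large. *)
Definition weighted_sum a : R := limn (series (fun j => if a j then w j else 0)).

Let sum_nd a : {homo series (term a) : m n / (m <= n)%N >-> m <= n}.
Proof.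
move=> m n mn; rewrite /series/= (big_cat_nat (leq0n m) mn)/= lerDl.
exact: sumr_ge0.
Qed.

(** The subtracted [2^-1 ^+ n] lets the induction on [n - m] close. *)
Let sum_tail a m n : (m <= n)%N ->
  series (term a) n <= series (term a) m + 2^-1 ^+ m - 2^-1 ^+ n.
Proof.
move=> mn; rewrite -(subnKC mn); elim: (n - m)%N => [|k ih].
  by rewrite addn0 addrK.
rewrite addnS seriesS; have : term a (m + k) <= 2^-1 ^+ (m + k).+1.
  by rewrite /term; case: ifP => // _; rewrite exprn_ge0// invr_ge0.
by move: ih; rewrite exprS; lra.
Qed.

Let sum_ub a m n : series (term a) n <= series (term a) m + 2^-1 ^+ m.
Proof.
have [mn|/ltnW nm] := leqP m n.
  by apply: le_trans (sum_tail a mn) _; rewrite gerBl exprn_ge0// invr_ge0.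
by apply: le_trans (sum_nd _ nm) _; rewrite lerDl exprn_ge0// invr_ge0.
Qed.

Let sum_cvg a : cvgn (series (term a)).
Proof.
apply: nondecreasing_is_cvgn; first exact: sum_nd.
by exists (series (term a) 0%N + 2^-1 ^+ 0) => _ [n _ <-]; exact: sum_ub.
Qed.

Let weighted_sum_bounds a n :
  series (term a) n <= weighted_sum a <= series (term a) n + 2^-1 ^+ n.
Proof.
apply/andP; split; first by apply: nondecreasing_cvgn_le; [exact: sum_nd|exact: sum_cvg].
by apply: limr_le; [exact: sum_cvg|near=> k; exact: sum_ub].
Unshelve. all: by end_near. Qed.

Lemma weighted_sum_itv a : 0 <= weighted_sum a <= 1.
Proof. by have := weighted_sum_bounds a 0; rewrite /series/= big_geq// add0r. Qed.

Lemma weighted_sum_agree n a b : agree n a b ->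
  `|weighted_sum a - weighted_sum b| <= 2^-1 ^+ n.
Proof.
move=> ab; have /andP[a1 a2] := weighted_sum_bounds a n.
have /andP[b1 b2] := weighted_sum_bounds b n.
have abE : series (term a) n = series (term b) n.
  by apply: eq_big_nat => j /andP[_ jn]; rewrite /term ab.
by rewrite ler_norml; apply/andP; split; move: a1 a2 b1 b2; rewrite abE; lra.
Qed.

(** Beyond index [j] the partial sums differ by the constant [w j], up to sign. *)
Lemma weighted_sum_flip j a : `|weighted_sum (flip j a) - weighted_sum a| = w j.
Proof.
have serE n : series (term (flip j a)) n =
    series (term a) n + (if (j < n)%N then if a j then - w j else w j else 0).
  elim: n => [|n ih]; first by rewrite /series/= !big_geq// addr0.
  rewrite !seriesS ih ltnS /term /flip; have [->|nj] := eqVneq n j.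
    by rewrite leqnn ltnn; case: (a j) => /=; lra.
  by rewrite addbF (leq_eqVlt j n) (eq_sym j n) (negbTE nj)/=; lra.
have -> : weighted_sum (flip j a) = weighted_sum a + (if a j then - w j else w j).
  apply: cvg_lim => //.
  have : series (term a) n + (if a j then - w j else w j) @[n --> \oo] -->
      weighted_sum a + (if a j then - w j else w j).
    by apply: cvgD; [exact: sum_cvg|exact: cvg_cst].
  apply: cvg_trans; apply: near_eq_cvg; near=> n.
  rewrite -/(term (flip j a)) serE (_ : (j < n)%N = true)//.
  by near: n; exact: nbhs_infty_gt.
by rewrite addrAC subrr add0r; case: ifP => _; rewrite ?normrN ger0_norm.
Unshelve. all: by end_near. Qed.

Definition weighted_point a : unitI R := clampI (weighted_sum a).

Lemma set_val_weighted_point a : set_val (weighted_point a) = weighted_sum a.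
Proof. by rewrite set_val_clampI// weighted_sum_itv. Qed.

End binary.

(** * Borel sets and the Baire property *)

(** [S] is arbitrary so as to serve both Borel sets and sets with the Baire property. *)
Lemma borel_preimage (T : Type) (Y : topologicalType) (S : set (set T)) (g : T -> Y) :
    sigma_algebra setT S -> (forall V, open V -> S (g @^-1` V)) ->
  forall B, borel_set B -> S (g @^-1` B).
Proof.
move=> [S0 SC SU] gS; apply: smallest_sub => //.
split=> [|A SA|A SA]; first by rewrite /= preimage_set0.
  by rewrite /= setTD preimage_setC -setTD; exact: SC.
by rewrite /= preimage_bigcup; exact: SU.
Qed.

Lemma borel_sigma_algebra (Y : topologicalType) : sigma_algebra setT (@borel_set Y).
Proof. exact: smallest_sigma_algebra. Qed.

Lemma unitI_nbhsP (R : realType) (t : unitI R) (V : set (unitI R)) :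
  nbhs t V <-> exists2 e : R, 0 < e &
    forall s : unitI R, `|set_val s - set_val t| < e -> V s.
Proof.
split=> [|[e e0 eV]].
  rewrite nbhsE => -[B [[C oC <-] /= Ct] BV].
  have /nbhs_ballP[e /= e0 eC] : nbhs (set_val t) C by exact: open_nbhs_nbhs.
  by exists e => // s st; apply: BV; apply: eC; rewrite /ball/= distrC.
rewrite nbhsE; exists (set_val @^-1` ball (set_val t) e); last first.
  by move=> s /=; rewrite /ball/= distrC; exact: eV.
split; last exact: ballxx.
by exists (ball (set_val t) e) => //; exact: ball_open.
Qed.

Lemma continuous_at0P (R : realType) (f : unitI R -> R) :
    (forall t, 0 <= f t) -> f (zeroI R) = 0 ->
  {for zeroI R, continuous f} <->
  forall e, 0 < e -> exists2 d, 0 < d & forall t, set_val t < d -> f t <= e.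
Proof.
move=> f0 f00; rewrite /prop_for /continuous_at f00.
have abst (t : unitI R) : `|set_val t - set_val (zeroI R)| = set_val t.
  by rewrite subr0 ger0_norm//; have /andP[] := unitI_itv t.
split=> [/(@cvgrPdist_le _ _ _ _ (nbhs_filter (zeroI R))) cf e e0|cf].
  have /unitI_nbhsP[d d0 dP] := cf e e0.
  by exists d => // t td; have := dP t; rewrite abst/= sub0r normrN ger0_norm//; apply.
apply/(@cvgrPdist_le _ _ _ _ (nbhs_filter (zeroI R))) => e e0.
apply/unitI_nbhsP; have [d d0 dP] := cf e e0.
by exists d => // t; rewrite abst/= sub0r normrN ger0_norm//; exact: dP.
Qed.

Section baire_fun.
Variable K : countType.

Definition cyl_nbhs (x : K -> bool) : set_system (K -> bool) :=
  [set A | exists m, forall y, agree m x y -> A y].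

Global Instance cyl_nbhs_filter x : Filter (cyl_nbhs x).
Proof.
split; first by exists 0%N.
  move=> A B [m mA] [n nB]; exists (maxn m n) => y xy; split.
    by apply: mA; apply: agree_le xy; exact: leq_maxl.
  by apply: nB; apply: agree_le xy; exact: leq_maxr.
by move=> A B AB [m mA]; exists m => y /mA/AB.
Qed.

Lemma cyl_open_preimage (Y : topologicalType) (g : (K -> bool) -> Y) :
    (forall x, g @ cyl_nbhs x --> g x) ->
  forall V, open V -> cyl_open (g @^-1` V).
Proof. by move=> cg V oV x Vx; apply: cg; exact: open_nbhs_nbhs. Qed.

Definition baire_fun (Y : topologicalType) (g : (K -> bool) -> Y) :=
  forall B, borel_set B -> baire (g @^-1` B).

Lemma cvg_baire_fun (Y : topologicalType) (g : (K -> bool) -> Y) :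
  (forall x, g @ cyl_nbhs x --> g x) -> baire_fun g.
Proof.
move=> cg; apply: borel_preimage; first exact: baire_sigma_algebra.
by move=> V oV; apply: baire_open; exact: cyl_open_preimage.
Qed.

Lemma baire_fun_comp (Y Z : topologicalType) (h : Y -> Z) (g : (K -> bool) -> Y) :
  borel_fun h -> baire_fun g -> baire_fun (h \o g).
Proof. by move=> bh bg B /bh/bg. Qed.

Variable R : realType.

Lemma cvg_unitI (g : (K -> bool) -> unitI R) x :
  (forall e, 0 < e -> exists m, forall y, agree m x y ->
    `|set_val (g y) - set_val (g x)| < e) -> g @ cyl_nbhs x --> g x.
Proof.
move=> gP V /unitI_nbhsP[e e0 eV]; have [m mP] := gP e e0.
by exists m => y /mP; exact: eV.
Qed.

Lemma cvg_cube (g : (K -> bool) -> cube R) x :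
  (forall n, g^~ n @ cyl_nbhs x --> g x n) -> g @ cyl_nbhs x --> g x.
Proof. by move=> gP; apply/pointwise_cvgP => n; exact: gP. Qed.

Lemma borel_fun_proj n : borel_fun (fun u : cube R => u n).
Proof.
apply: borel_preimage; first exact: borel_sigma_algebra.
move=> V oV; apply: sub_sigma_algebra; move: V oV; apply/continuousP.
exact: (@proj_continuous nat (fun=> unitI R) n).
Qed.

(** Taking the sets with the Baire property as measurable sets reduces this to measurability of real
    differences and absolute values. *)
Lemma baire_distI (g h : (K -> bool) -> unitI R) :
  baire_fun g -> baire_fun h -> baire_fun (fun x => distI (g x) (h x)).
Proof.
move=> bg bh; pose T := g_sigma_algebraType (@baire K).
have mval (k : (K -> bool) -> unitI R) : baire_fun k ->
    measurable_fun setT (fun x : T => set_val (k x) : R).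
  move=> bk; apply: (measurability _ (RGenOpens.measurableE R)).
  move=> _ [_ [a [b ->]] <-]; rewrite setTI; apply: sub_sigma_algebra.
  have := bk ((set_val : unitI R -> R) @^-1` `]a, b[%classic); apply.
  apply: sub_sigma_algebra.
  by exists `]a, b[%classic => //; exact: interval_open.
have mdist : measurable_fun setT (fun x : T => set_val (distI (g x) (h x)) : R).
  have := measurable_funB (mval _ bh) (mval _ bg).
  move=> /(measurableT_comp (@normr_measurable R setT)) mnorm.
  rewrite (_ : (fun x => _) = Num.Def.normr \o
    ((fun x : T => set_val (h x) : R) \- (fun x : T => set_val (g x) : R)))//.
apply: borel_preimage; first exact: baire_sigma_algebra.
move=> _ [V oV <-]; apply: (@sub_baire K (@baire K)) => //.
have := mdist measurableT V (open_measurable oV).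
by rewrite setTI.
Qed.

Lemma baire_dist_sum (f : unitI R -> R) (psi phi : (K -> bool) -> cube R) m n c :
    borel_fun f -> (forall i, baire_fun (fun x => psi x i)) ->
    (forall i, baire_fun (fun x => phi x i)) ->
  baire [set x | dist_sum f m n (psi x) (phi x) <= c].
Proof.
move=> bf bpsi bphi; pose T := g_sigma_algebraType (@baire K).
have : measurable_fun setT (fun x : T => dist_sum f m n (psi x) (phi x)).
  apply: measurable_sum => i.
  apply: (measurability _ (RGenOpens.measurableE R)).
  move=> _ [_ [a [b ->]] <-]; rewrite setTI; apply: sub_sigma_algebra.
  have := baire_distI (bpsi i) (bphi i).
  move=> /(_ (f @^-1` `]a, b[%classic)); apply; apply: bf.
  by apply: sub_sigma_algebra; exact: interval_open.
move=> /(_ measurableT `]-oo, c]%classic (measurable_itv _)).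
by rewrite setTI => /(sub_baire (@subset_refl _ _)); congr baire.
Qed.

End baire_fun.

(** * No reduction when f is continuous at 0 *)

(** Pigeonhole; it supplies bits of a fixed row or factor with arbitrarily large code. *)
Lemma injective_unbounded (g : nat -> nat) (m : nat) :
  injective g -> exists j, (m <= g j)%N.
Proof.
move=> g_inj; apply: contrapT => nj.
have gm j : (g j < m)%N by rewrite ltnNge; apply/negP => mj; apply: nj; exists j.
have : injective (fun j : 'I_m.+1 => Ordinal (gm j)).
  by move=> i j [/g_inj/val_inj].
by move=> /leq_card; rewrite !card_ord ltnn.
Qed.

Definition bit_row (n : nat) (x : nat * nat -> bool) : nat -> bool := fun j => x (n, j).

Lemma rows_cvg (R : realType) (h : (nat -> bool) -> unitI R) :
    (forall a e, 0 < e -> exists m, forall b, agree m a b ->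
      `|set_val (h b) - set_val (h a)| < e) ->
  forall x, (fun y => (fun n => h (bit_row n y)) : cube R) @ cyl_nbhs x -->
    ((fun n => h (bit_row n x)) : cube R).
Proof.
move=> hc x; apply: cvg_cube => n; apply: cvg_unitI => e e0.
have [m mP] := hc (bit_row n x) e e0.
have [m' m'P] := agree_comp (@pair nat nat n) m.
by exists m' => y xy; apply: mP; exact: m'P xy.
Qed.

Lemma weighted_point_continuous (R : realType) (w : nat -> R) :
    (forall j, 0 <= w j) -> (forall j, w j <= 2^-1 ^+ j.+1) ->
  forall a e, 0 < e -> exists m, forall b, agree m a b ->
    `|set_val (weighted_point w b) - set_val (weighted_point w a)| < e.
Proof.
move=> w0 w1 a e e0.
have [m me] : exists m, 2^-1 ^+ m < e.
  have : (2^-1 : R) ^+ n @[n --> \oo] --> 0.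
    by apply: cvg_expr; rewrite ger0_norm; lra.
  move=> /cvgrPdist_lt/(_ e e0)[m _ /(_ m)]/(_ (leqnn _))/=.
  by rewrite sub0r normrN ger0_norm ?exprn_ge0// => ?; exists m.
exists m => b /agree_sym ab; rewrite !set_val_weighted_point//.
by apply: le_lt_trans me; exact: weighted_sum_agree.
Qed.

Lemma rational_approx (R : realType) (t : unitI R) (e : R) : 0 < e ->
  exists q : rat, `|set_val (clampI (ratr q : R)) - set_val t| < e.
Proof.
move=> e0; have /andP[t0 t1] := unitI_itv t.
(* Staying inside the unit interval keeps [clampI] from replacing [ratr q] by 0. *)
have : Num.max 0 (set_val t - e) < Num.min 1 (set_val t + e).
  by rewrite gt_max !lt_min; apply/andP; split; apply/andP; split; lra.
move=> /rat_in_itvoo[q]; rewrite in_itv/= gt_max lt_min.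
move=> /andP[/andP[q0 qt] /andP[q1 tq]]; exists q.
by rewrite set_val_clampI ?ltW// ltr_norml; apply/andP; split; lra.
Qed.

Section continuous_case.
Variables (R : realType) (f : unitI R -> R).
Hypothesis f_ge0 : forall t, 0 <= f t.
Hypothesis f_borel : borel_fun f.
Hypothesis Ef_equiv : RelationClasses.Equivalence (Esum f).
Hypothesis f_cont : forall e, 0 < e ->
  exists2 d, 0 < d & forall t, set_val t < d -> f t <= e.

(** For a fixed [v] there are only countably many splices, which makes a countable cover
    possible. *)
Definition splice (q : seq rat) (v : cube R) : cube R :=
  fun n => if (n < size q)%N then clampI (ratr (nth 0 q n)) else v n.

Lemma dist_sum_xx n (u : cube R) : dist_sum f 0 n u u = 0.
Proof. by rewrite /dist_sum big1// => i _; rewrite distIxx (f_zeroI f_ge0 Ef_equiv). Qed.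

Lemma Esum_splice (u v : cube R) (d : R) : Esum f u v -> 0 < d ->
  exists q, forall n, dist_sum f 0 n u (splice q v) <= d.
Proof.
move=> uv d0; have d20 : 0 < d / 2 by rewrite divr_gt0.
have [N NP] := Esum_tail f_ge0 uv d20.
(* The first [N] terms share [d / 2], the tail costs the other half; [N.+1] avoids division by
   zero. *)
have [c c0 cP] := f_cont (divr_gt0 d20 (ltr0Sn R N)).
have /choice[r rP] : forall n, exists q : rat,
    `|set_val (clampI (ratr q : R)) - set_val (u n)| < c.
  by move=> n; exact: rational_approx.
exists (mkseq r N) => n.
apply: le_trans (dist_sum_le f_ge0 _ _ (leq_maxl n N)) _.
rewrite (@dist_sum_cat _ _ N)// ?leq_maxr// [leRHS]splitr; apply: lerD.
  apply: (@le_trans _ _ (\sum_(0 <= i < N) (d / 2 / N.+1%:R))).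
    apply: ler_sum_nat => i /andP[_ iN]; apply: cP.
    by rewrite /splice size_mkseq iN nth_mkseq// set_val_distI.
  rewrite sumr_const_nat subn0 -[leLHS]mulr_natr mulrAC ler_pdivrMr ?ltr0Sn//.
  by rewrite ler_pM2l// ler_nat.
apply: le_trans (NP (maxn n N)); apply: ler_sum_nat => i /andP[Ni _].
by rewrite /splice size_mkseq ltnNge Ni.
Qed.

(** An error budget: a finite chain of errors [e i.+1, e i.+2, ...], folded from the right, stays
    within [e i]. *)
Lemma dist_sum_trans_seq : exists e : nat -> R, forall i, 0 < e i /\
  forall n u v w, dist_sum f 0 n u v <= e i.+1 -> dist_sum f 0 n v w <= e i.+1 ->
    dist_sum f 0 n u w <= e i.
Proof.
(* Under the guard [0 < e] every real has a successor, as dependent choice demands; positivity is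
   recovered by induction. *)
pose P (_ : nat) (e d : R) := 0 < e -> 0 < d /\
  forall n u v w, dist_sum f 0 n u v <= d -> dist_sum f 0 n v w <= d ->
    dist_sum f 0 n u w <= e.
have step i e : exists d, P i e d.
  have [e0|e0] := ltP 0 e; last by exists 0; rewrite /P ltNge e0.
  by have [d d0 dP] := dist_sum_trans f_ge0 Ef_equiv e0; exists d.
have [e e1 eP] := dependent_choice_nat 1 step.
have e0 i : 0 < e i by elim: i => [|i /eP[]//]; rewrite e1.
by exists e => i; split=> //; have [] := eP i (e0 i).
Qed.

Let K : countType := (nat * nat)%type.
Let half (j : nat) : R := 2^-1 ^+ j.+1.
Let half_ge0 j : 0 <= half j. Proof. by rewrite exprn_ge0// invr_ge0. Qed.

Let emb (x : K -> bool) : cube R := fun n => weighted_point half (bit_row n x).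

Let zero_row (k : nat) (x : K -> bool) : K -> bool :=
  fun p => if p.1 == k then false else x p.

Let emb_cvg x : emb @ cyl_nbhs x --> emb x.
Proof. by apply: rows_cvg; exact: weighted_point_continuous. Qed.

Let emb_zero_row_cvg k x : emb \o zero_row k @ cyl_nbhs x --> emb (zero_row k x).
Proof.
apply: cvg_trans (@emb_cvg (zero_row k x)) => A [m mA]; exists m => y xy.
by apply: mA => p pm; rewrite /zero_row; case: ifP => // _; exact: xy.
Qed.

Lemma E1_not_reducible : ~ borel_reducible (@E1 R) (Esum f).
Proof.
move=> [theta theta_borel theta_red].
have [e eP] := dist_sum_trans_seq.
pose psi x : cube R := theta (emb x).
have psi_baire n : baire_fun (fun x => psi x n).
  exact: (baire_fun_comp (borel_fun_proj n)
    (baire_fun_comp theta_borel (cvg_baire_fun emb_cvg))).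
have psi0_baire k n : baire_fun (fun x => psi (zero_row k x) n).
  exact: (baire_fun_comp (borel_fun_proj n)
    (baire_fun_comp theta_borel (cvg_baire_fun (@emb_zero_row_cvg k)))).
(* The [inl] sets compare [psi x] with a splice of the image of the row-erased point; the [inr] sets
   make every coordinate of [psi] continuous on generic points. *)
pose A (j : (nat * seq rat + nat * (rat * rat))%type) : set (K -> bool) :=
  match j with
  | inl (k, q) => [set x | forall n,
      dist_sum f 0 n (psi x) (splice q (psi (zero_row k x))) <= e k.+3]
  | inr (n, (p, q)) => [set x | ratr p < set_val (psi x n) < ratr q]
  end.
have A_baire j : baire (A j).
  case: j => [[k q]|[n [p q]]] /=.
    rewrite (_ : [set x | _] = \bigcap_n [set x |
        dist_sum f 0 n (psi x) (splice q (psi (zero_row k x))) <= e k.+3]).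
      apply: sigma_algebra_countable_bigcap (@baire_sigma_algebra K) _ _ _ => n.
      apply: baire_dist_sum => // i.
      rewrite /splice; case: (i < size q)%N; last exact: psi0_baire.
      by apply: cvg_baire_fun => x; exact: cvg_cst.
    by apply/seteqP; split=> x xP n => [_|]; exact: xP.
  rewrite (_ : [set x | ratr p < set_val (psi x n) < ratr q] = (fun x => psi x n)
    @^-1` ((set_val : unitI R -> R) @^-1` `]ratr p, ratr q[%classic)).
    apply: psi_baire; apply: sub_sigma_algebra.
    by exists `]ratr p, ratr q[%classic => //; exact: interval_open.
  by apply/seteqP; split=> x /=; rewrite in_itv.
(* [G] is the set of generic points: it is invariant under flips, and on it each
   [A j] coincides with an open set. *)
have [U [W [U_open W_od AU W_flip]]] := baire_generic A_baire.
set G := \bigcap_n W n in AU W_flip.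
have [x0 Gx0] : exists x, G x by apply: comeager_nonempty; exists W.
have zero_row_flip k j x : zero_row k (flip (k, j) x) = zero_row k x.
  apply/funext => -[k' j']; rewrite /zero_row/= /flip xpair_eqE.
  by case: eqP => //=; rewrite addbF.
(* [emb x] and [emb (zero_row k x)] agree past coordinate [k], so their images are equivalent. *)
have cover k x : exists q, A (inl (k, q)) x.
  apply: Esum_splice; last by have [] := eP k.+3.
  apply/theta_red; exists k.+1 => // n kn; rewrite /emb.
  congr (weighted_point _ _); apply/funext => j; rewrite /bit_row /zero_row/=.
  by case: eqP => // nk; move: kn; rewrite /= nk ltnn.
(* The error [e k.+2] of step [k] leaves room for the remaining steps: by uniform
   transitivity all steps from [k] on add up to at most [e k.+1]. *)
pose P (k : nat) (s s' : (K -> bool) * nat) := G s.1 ->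
  [/\ exists j, s'.1 = flip (k, j) s.1, agree s.2 s.1 s'.1, (s.2 < s'.2)%N,
      forall n, dist_sum f 0 n (psi s.1) (psi s'.1) <= e k.+2 &
      forall y, agree s'.2 s'.1 y -> W k y].
have step k s : exists s', P k s s'.
  case: s => x m; have [Gx|nG] := pselect (G x); last by exists (x, m).
  have [q Bx] := cover k x.
  have [m1 m1P] := U_open _ _ ((AU _ _ Gx).1 Bx).
  (* A code of at least [m] preserves the current prefix; at least [m1] keeps the flip inside the
     open set. *)
  have [|j jm] := @injective_unbounded (fun j => pickle (k, j)) (maxn m m1).
    by move=> i j /(pcan_inj pickleK)[].
  have Gx' : G (flip (k, j) x) by exact: W_flip.
  have [m2 m2P] : exists m2, forall y, agree m2 (flip (k, j) x) y -> W k y.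
    by have [oW _] := W_od k; apply: oW; exact: Gx'.
  exists (flip (k, j) x, maxn m.+1 m2) => _; split => /=.
  - by exists j.
  - by apply: agree_flip_ge; apply: leq_trans jm; exact: leq_maxl.
  - by rewrite leq_maxl.
  (* Erasing row [k] undoes the flip, so [x] and its flip are within [e k.+3] of the same splice. *)
  - move=> n; have [_ tr] := eP k.+2; apply: tr (Bx n) _.
    rewrite dist_sumC -(zero_row_flip k j x).
    suff : A (inl (k, q)) (flip (k, j) x) by apply.
    apply/AU => //; apply: m1P; apply: agree_flip_ge.
    by apply: leq_trans jm; exact: leq_maxr.
  - by move=> y xy; apply: m2P; apply: agree_le xy; exact: leq_maxr.
have [s s0 sP] := dependent_choice_nat (x0, 0%N) step.
have Gs n : G (s n).1.
  by elim: n => [|n ih]; [rewrite s0|have [[j ->] _ _ _ _] := sP n ih; exact: W_flip].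
have s_ge n : (n <= (s n).2)%N.
  by elim: n => // n ih; apply: leq_ltn_trans ih _; have [] := sP n (Gs n).
have [|n|x1 x1P] := @agree_limit K (fun n => (s n).1) (fun n => (s n).2) s_ge.
- by move=> n; apply: ltnW; have [] := sP n (Gs n).
- by have [] := sP n (Gs n).
have Gx1 : G x1 by move=> n _; have [_ _ _ _] := sP n (Gs n); apply; exact: x1P.
have /choice[jj jjP] : forall n, exists j, (s n.+1).1 = flip (n, j) (s n).1.
  by move=> n; have [] := sP n (Gs n).
(* Row [k] changes only in step [k], at bit [jj k]. *)
have row_s k n : bit_row k (s n).1 =
    if (k < n)%N then flip (jj k) (bit_row k x0) else bit_row k x0.
  elim: n => [|n ih]; first by rewrite s0.
  have rowflip i j x : bit_row k (flip (i, j) x) =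
      if k == i then flip j (bit_row k x) else bit_row k x.
    apply/funext => j'; rewrite /bit_row /flip xpair_eqE.
    by case: eqP => //= _; rewrite addbF.
  rewrite jjP rowflip ih ltnS (leq_eqVlt k n).
  by have [->|_] := eqVneq k n; rewrite ?ltnn.
have row_x1 k : bit_row k x1 = flip (jj k) (bit_row k x0).
  apply/funext => j; pose n := maxn k.+1 (pickle (k, j)).+1.
  have := row_s k n; rewrite leq_maxl => <-.
  by rewrite /bit_row (x1P n)// ; apply: leq_trans (s_ge n); exact: leq_maxr.
(* Coordinate [n] differs by the nonzero weight of bit [jj n]. *)
have nE1 : ~ E1 (emb x0) (emb x1).
  move=> [n _ /(_ n (leqnn n))] /(congr1 (@set_val _ _)).
  rewrite /emb row_x1 !set_val_weighted_point// => /esym eq01.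
  have := weighted_sum_flip half_ge0 (fun j => lexx (half j)) (jj n) (bit_row n x0).
  rewrite eq01 subrr normr0 => /eqP; rewrite eq_sym /half expf_eq0/= invr_eq0.
  by rewrite pnatr_eq0.
apply/nE1/theta_red/(EsumP f_ge0); exists (e 0%N) => M.
(* Step [k] costs [e k.+2], and by induction so do all later ones together. *)
have chain k n : dist_sum f 0 M (psi (s k).1) (psi (s (n + k)%N).1) <= e k.+1.
  elim: n k => [|n ih] k; first by rewrite dist_sum_xx ltW//; have [] := eP k.+1.
  have [_ tr] := eP k.+1; apply: (tr M _ (psi (s k.+1).1)).
    by have [_ _ _ ? _] := sP k (Gs k).
  by rewrite addSnnS; exact: ih.
(* Near [x1] the [inr] set of a rational interval around [psi x1 i] contains all generic points,
   hence the late [s n]. *)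
have coord i d : 0 < d -> exists N, forall n, (N <= n)%N ->
    set_val (distI (psi (s n).1 i) (psi x1 i)) < d.
  move=> d0.
  have /rat_in_itvoo[p] : set_val (psi x1 i) - d / 2 < set_val (psi x1 i) by lra.
  have /rat_in_itvoo[q] : set_val (psi x1 i) < set_val (psi x1 i) + d / 2 by lra.
  rewrite !in_itv/= => /andP[q1 q2] /andP[p1 p2].
  have Ax1 : A (inr (i, (p, q))) x1 by rewrite /A/= p2 q1.
  have [N NP] := U_open _ _ ((AU _ _ Gx1).1 Ax1).
  exists N => n Nn; have /(AU _ _ (Gs n)).2 : U (inr (i, (p, q))) (s n).1.
    apply: NP; apply: agree_sym; apply: agree_le (x1P n).
    exact: leq_trans (s_ge n).
  rewrite /A/= => /andP[p3 q3]; rewrite set_val_distI ltr_norml.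
  by apply/andP; split; lra.
(* Here continuity at 0 turns coordinatewise convergence into small partial sums. *)
have limD m d : 0 < d -> exists N, forall n, (N <= n)%N ->
    dist_sum f 0 m (psi (s n).1) (psi x1) <= d.
  elim: m d => [|m ih] d d0.
    by exists 0%N => n _; rewrite /dist_sum big_geq// ltW.
  have d20 : 0 < d / 2 by rewrite divr_gt0.
  have [N1 N1P] := ih _ d20.
  have [c c0 cP] := f_cont d20; have [N2 N2P] := coord m c c0.
  exists (maxn N1 N2) => n; rewrite geq_max => /andP[n1 n2].
  rewrite /dist_sum big_nat_recr//= [leRHS]splitr; apply: lerD; first exact: N1P.
  by apply: cP; exact: N2P.
(* [N] depends on [M], but the resulting bound [e 0] does not. *)
have [e1 _] := eP 1%N; have [N NP] := limD M _ e1.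
have [_ tr] := eP 0%N; apply: (tr M _ (psi (s N).1)); last exact: NP.
by have := chain 0%N N; rewrite addn0 s0.
Qed.

End continuous_case.

(** * A reduction when f is discontinuous at 0 *)

(** An open set is a union of cylinders, which are coded by finite words; measurable bits make each
    cylinder measurable. *)
Lemma cyl_open_measurable (K : countType) (T : Type) (S : set (set T))
    (g : T -> K -> bool) :
    sigma_algebra setT S -> (forall k, S [set t | g t k]) ->
  forall V, cyl_open V -> S (g @^-1` V).
Proof.
move=> S_sigma Sg V oV; have S0 : S set0 by case: S_sigma.
pose C (s : seq bool) : set T := \bigcap_k
  [set t | (pickle k < size s)%N -> g t k = nth false s (pickle k)].
have SC s : S (C s).
  apply: sigma_algebra_countable_bigcap => // k.
  case: (ltnP (pickle k) (size s)) => _; last first.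
    rewrite (_ : [set _ | _] = ~` set0); first exact: sigma_algebra_setC.
    by rewrite setC0; apply/seteqP; split.
  case: (nth false s (pickle k)).
    by rewrite (_ : [set _ | _] = [set t | g t k])//; apply/seteqP; split=> t;
      [apply|move=> /= gt _].
  rewrite (_ : [set _ | _] = ~` [set t | g t k]); first exact: sigma_algebra_setC.
  by apply/seteqP; split=> t /=; case: (g t k) => // /(_ isT).
rewrite (_ : g @^-1` V =
    \bigcup_s (if pselect (C s `<=` g @^-1` V) then C s else set0)).
  by apply: sigma_algebra_countable_bigcup => // s; case: pselect => ? /=.
apply/seteqP; split=> [t Vt|t [s _]]; last first.
  by case: pselect => // sV /sV.
have [m mP] := oV _ Vt.
pose s := mkseq (fun n => if unpickle n is Some k then g t k else false) m.
have sE (k : K) : (pickle k < m)%N -> nth false s (pickle k) = g t k.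
  by move=> km; rewrite nth_mkseq// pickleK.
exists s => //; case: pselect => [?|[]] /=.
  by move=> k _ /=; rewrite size_mkseq => /sE.
move=> t' Ct'; apply: mP => k km; rewrite -sE//; apply/esym/Ct' => //.
by rewrite size_mkseq.
Qed.

Section discontinuous_case.
Variables (R : realType) (f : unitI R -> R).
Hypothesis f_ge0 : forall t, 0 <= f t.
Hypothesis f_borel : borel_fun f.
Hypothesis Ef_equiv : RelationClasses.Equivalence (Esum f).

(** A generic pair has [f] above [d]: otherwise flipping a late bit [j] of one member gives
    [f (t j) <= e] by [f_trans]. Mycielski's theorem makes all distinct pairs generic. *)
Lemma separating_map (e : R) : 0 < e ->
    (forall d, 0 < d -> exists2 t, set_val t < d & e < f t) ->
  exists2 d, 0 < d & exists2 h : (nat -> bool) -> unitI R,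
    forall a c, 0 < c -> exists m, forall b, agree m a b ->
      `|set_val (h b) - set_val (h a)| < c &
    forall a b, a <> b -> d < f (distI (h a) (h b)).
Proof.
move=> e0 disc; have /choice[t tP] : forall j, exists t,
    set_val t <= (2^-1 : R) ^+ j.+1 /\ e < f t.
  move=> j; have [|t tj ft] := disc (2^-1 ^+ j.+1).
    by rewrite exprn_gt0// invr_gt0.
  by exists t; rewrite ltW.
pose w j := set_val (t j).
have w0 j : 0 <= w j by have /andP[] := unitI_itv (t j).
have w1 j : w j <= 2^-1 ^+ j.+1 by have [] := tP j.
pose h := weighted_point w.
have hflip j a : distI (h a) (h (flip j a)) = t j.
  by apply: unitI_inj; rewrite set_val_distI !set_val_weighted_point// weighted_sum_flip.
have hc := weighted_point_continuous w0 w1.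
have [d d0 dP] := f_trans f_ge0 Ef_equiv e0.
pose side c (x : bool * nat -> bool) : nat -> bool := fun j => x (c, j).
have h_baire c : baire_fun (fun x => h (side c x)).
  apply: cvg_baire_fun => x; apply: cvg_unitI => r r0.
  have [m mP] := hc (side c x) r r0.
  have [n nP] := agree_comp (@pair bool nat c) m.
  by exists n => y xy; apply: mP; exact: nP xy.
pose A (_ : unit) : set (bool * nat -> bool) :=
  [set x | f (distI (h (side true x)) (h (side false x))) <= d].
have A_baire j : baire (A j).
  have := @baire_dist_sum _ R f (fun x _ => h (side true x))
    (fun x _ => h (side false x)) 0 1 d f_borel
    (fun=> h_baire true) (fun=> h_baire false).
  by congr baire; apply/seteqP; split=> x; rewrite /A/= /dist_sum big_nat1.
have [U [W [U_open W_od AU W_flip]]] := baire_generic A_baire.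
have nA x : (\bigcap_n W n) x -> ~ A tt x.
  move=> Wx Ax; have [m mP] := U_open _ _ ((AU tt _ Wx).1 Ax).
  have [|j mj] := @injective_unbounded (fun j => pickle (true, j)) m.
    by move=> i j /(pcan_inj pickleK)[].
  have : A tt (flip (true, j) x).
    by apply/AU; [exact: W_flip|apply: mP; exact: agree_flip_ge].
  have -> : A tt (flip (true, j) x) =
      (f (distI (h (side false x)) (h (flip j (side true x)))) <= d) :> Prop.
    rewrite /A/= distIC; congr (is_true (f (distI (h _) (h _)) <= d)).
      by apply/funext => i; rewrite /side /flip addbF.
  move=> /(dP _ _ _ Ax); rewrite hflip leNgt; have [_ ->] := tP j.
  by [].
have [phi phi_cont phiP] := mycielski W_od.
exists d => //; exists (h \o phi).
  move=> a c c0; have [m mP] := hc (phi a) c c0; have [n nP] := phi_cont a m.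
  by exists n => b /nP/mP.
move=> a b /phiP/nA/negP; rewrite -ltNge; congr (d < f (distI (h _) (h _))).
Qed.

(** An injective code of [t] each of whose bits is an open condition. *)
Definition rational_cut (t : unitI R) : nat -> bool :=
  fun j => if unpickle j is Some q then ratr q < set_val t else false.

Lemma rational_cut_inj : injective rational_cut.
Proof.
have lt_neq s t : set_val s < set_val t -> rational_cut s <> rational_cut t.
  move=> /rat_in_itvoo[q]; rewrite in_itv/= => /andP[sq qt].
  move=> /(congr1 (@^~ (pickle q))); rewrite /rational_cut pickleK qt.
  by rewrite ltNge ltW.
move=> s t st; apply: unitI_inj; apply/eqP; case: ltgtP => // /lt_neq.
  by move/(_ st).
by move/(_ (esym st)).
Qed.

Lemma E1_reducible (e : R) : 0 < e ->
    (forall d, 0 < d -> exists2 t, set_val t < d & e < f t) ->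
  borel_reducible (@E1 R) (Esum f).
Proof.
move=> e0 /(separating_map e0)[d d0 [h h_cont hP]].
pose code (u : cube R) : nat * nat -> bool := fun p => rational_cut (u p.1) p.2.
pose rows (x : nat * nat -> bool) : cube R := fun n => h (bit_row n x).
exists (rows \o code).
  apply: borel_preimage; first exact: borel_sigma_algebra.
  (* [rows] is continuous and [code] is Borel bit by bit. *)
  move=> V oV; have rV := cyl_open_preimage (rows_cvg h_cont) oV.
  apply: (cyl_open_measurable (borel_sigma_algebra (cube R)) _ rV) => -[n j].
  rewrite /code /rational_cut/=; case: unpickle => [q|]; last first.
    rewrite (_ : [set _ | _] = set0); first by have [] := borel_sigma_algebra (cube R).
    by apply/seteqP; split.
  apply: (borel_fun_proj n (B := [set t : unitI R | ratr q < set_val t])).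
  apply: sub_sigma_algebra; exists `]ratr q, +oo[%classic.
    exact: rray_open.
  by apply/seteqP; split=> t /=; rewrite in_itv/= andbT.
have dist0 (u v : cube R) n : u n = v n ->
    f (distI ((rows \o code) u n) ((rows \o code) v n)) = 0.
  move=> uvn; rewrite (_ : (rows \o code) u n = (rows \o code) v n).
    by rewrite distIxx (f_zeroI f_ge0 Ef_equiv).
  by congr h; apply/funext => j; rewrite /bit_row /code/= uvn.
move=> u v; split.
  move=> [N _ NP]; apply/(EsumP f_ge0).
  exists (dist_sum f 0 N ((rows \o code) u) ((rows \o code) v)) => n.
  apply: le_trans (dist_sum_le f_ge0 _ _ (leq_maxl n N)) _.
  rewrite (@dist_sum_cat _ _ N)// ?leq_maxr// gerDl.
  rewrite /dist_sum big_nat_cond big1// => i /andP[/andP[Ni _] _].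
  by apply: dist0; exact: NP.
have d20 : 0 < d / 2 by rewrite divr_gt0.
(* Past the point where tails are at most [d / 2], a differing coordinate would cost more than
   [d]. *)
move=> /(Esum_tail f_ge0)/(_ d20)[N NP]; exists N => // n /= Nn.
apply: contrapT => uvn; have := NP n.+1; apply/negP; rewrite -ltNge.
apply: (@lt_le_trans _ _ d); first by lra.
have := hP (rational_cut (u n)) (rational_cut (v n)).
move=> /(_ (contra_not (@rational_cut_inj _ _) uvn))/ltW/le_trans; apply.
rewrite /dist_sum big_nat_recr//= lerDr.
exact: (dist_sum_ge0 f_ge0).
Qed.

End discontinuous_case.

Theorem theorem4 (R : realType) (f : unitI R -> R)
    (f_ge0 : forall t : unitI R, 0 <= f t)
    (f_bounded : bounded_fun f)
    (f_borel : borel_fun f)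
    (Ef_equiv : RelationClasses.Equivalence (Esum f)) :
  {for zeroI R, continuous f} <-> ~ borel_reducible (@E1 R) (Esum f).
Proof.
rewrite (continuous_at0P f_ge0 (f_zeroI f_ge0 Ef_equiv)); split.
  exact: E1_not_reducible.
(* Failure of continuity gives a fixed [e] exceeded by [f] at points arbitrarily close to 0. *)
move=> nred e e0; apply: contrapT => nd; apply: nred.
apply: (E1_reducible f_ge0 f_borel Ef_equiv e0) => d d0.
apply: contrapT => nt; apply: nd; exists d => // t td.
by rewrite leNgt; apply/negP => ft; apply: nt; exists t.
Qed.
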